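(* Let $p$ and $\beta^*\in\mathbb{R}^p$ be fixed and assume $\mathbf{C}_n=n^{-1}X'X\to\mathbf{C}$ as $n\to\infty$, with $\mathbf{C}$ positive definite. Suppose there exist sequences of positive regularization parameters $(\lambda_n,\mu_n)$, with $\mu_n\to\mu$ and $\mu_n/\lambda_n\to\gamma$ (finite limits), such that $\hat\beta^{SL}$ converges to $\beta^*$ in probability and $\mathcal{A}_n$ converges to $\mathcal{A}^*$ in probability (that is, $\mathbb{P}(\mathcal{A}_n=\mathcal{A}^* )\to1$). Then for every $j\in(\mathcal{A}^* )^c$, $$\left|\mathbf{C}_{j,\mathcal{A}^*}\left(\mathbf{C}_{\mathcal{A}^*,\mathcal{A}^*}+\mu\widetilde J_{\mathcal{A}^*,\mathcal{A}^*}\right)^{-1}\left(2^{-1}\mathrm{Sgn}(\beta^*_{\mathcal{A}^*})+\gamma\,\widetilde J_{\mathcal{A}^*,\mathcal{A}^*}\beta^*_{\mathcal{A}^*}\right)-\gamma\,\widetilde J_{j,\mathcal{A}^*}\beta^*_{\mathcal{A}^*}\right|\le1.$$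
   Context: Model: for each $n$, $y_i=x_i\beta^*+\varepsilon_i$, $i=1,\dots,n$, where the $x_i=(x_{i,1},\dots,x_{i,p})\in\mathbb{R}^p$ are deterministic row vectors and $\varepsilon_1,\dots,\varepsilon_n$ are i.i.d. centered Gaussian with variance $\sigma^2$. $X$ is the $n\times p$ matrix with rows $x_i$ and $Y=(y_1,\dots,y_n)'$. The design is standardized: $n^{-1}\sum_{i=1}^n x_{i,j}^2=1$ and $n^{-1}\sum_{i=1}^n x_{i,j}=0$ for every $j$. For $a\in\mathbb{R}^n$, $\|a\|_n^2=n^{-1}\sum_{i=1}^n|a_i|^2$; for $a\in\mathbb{R}^p$, $|a|_1=\sum_{j=1}^p|a_j|$. The S-Lasso estimator $\hat\beta^{SL}$ is a minimizer over $\beta\in\mathbb{R}^p$ of $$\|Y-X\beta\|_n^2+\lambda_n|\beta|_1+\mu_n\sum_{j=2}^p(\beta_j-\beta_{j-1})^2.$$ Set $\mathcal{A}^*=\{j:\beta^*_j\neq0\}$ and $\mathcal{A}_n=\{j:\hat\beta^{SL}_j\neq0\}$. The $p\times p$ matrix $\widetilde J$ is the symmetric positive semidefinite matrix with $\beta'\widetilde J\beta=\sum_{j=2}^p(\beta_j-\beta_{j-1})^2$, i.e. tridiagonal with diagonal $(1,2,\dots,2,1)$ and off-diagonal entries $-1$. For index sets $\mathcal{B},\mathcal{B}'$, $M_{\mathcal{B},\mathcal{B}'}$ is the submatrix of $M$ with row indices in $\mathcal{B}$ and column indices in $\mathcal{B}'$ (with $j$ standing for $\{j\}$), and $a_{\mathcal{B}}$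 is the restriction of the vector $a$ to $\mathcal{B}$. $\mathrm{Sgn}(x)$ equals $1,-1,0$ according as $x>0$, $x<0$, $x=0$, applied componentwise to vectors. *)

(* Defs.v *)
From HB Require Import structures.
From mathcomp Require Import all_boot all_order all_algebra.
From mathcomp Require Import all_classical all_reals all_analysis.
From mathcomp Require Import ring.

Set Implicit Arguments.
Unset Strict Implicit.
Unset Printing Implicit Defensive.

Import Order.TTheory GRing.Theory Num.Theory.
Import numFieldNormedType.Exports.

Local Open Scope classical_set_scope.
Local Open Scope ring_scope.

Section Deterministic.
Variable R : realType.

Definition sqnormn n (a : 'cV[R]_n) : R :=
  n%:R^-1 * \sum_(i < n) `|a i 0| ^+ 2.

Definition l1norm p (a : 'cV[R]_p) : R := \sum_(j < p) `|a j 0|.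

(* The pair jk runs over consecutive indices: jk.1 is j - 1 and jk.2 is j. *)
Definition fusion p (b : 'cV[R]_p) : R :=
  \sum_(jk : 'I_p * 'I_p | jk.2 == jk.1.+1 :> nat)
     (b jk.2 0 - b jk.1 0) ^+ 2.

(* Diagonal (1, 2, ..., 2, 1): index j has a left neighbour when 0 < j and a
   right neighbour when j.+1 < p; in particular the matrix is 0 when p = 1. *)
Definition Jtilde p : 'M[R]_p :=
  \matrix_(j, k)
     if j == k then (0 < j)%N%:R + (j.+1 < p)%N%:R
     else if (k == j.+1 :> nat) || (j == k.+1 :> nat) then -1 else 0.

Definition slasso_objective n p (X : 'M[R]_(n, p)) (Y : 'cV[R]_n)
    (lambda mu : R) (b : 'cV[R]_p) : R :=
  sqnormn (Y - X *m b) + lambda * l1norm b + mu * fusion b.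

(* Not necessarily unique: the objective need not be strictly convex. *)
Definition is_slasso n p (X : 'M[R]_(n, p)) (Y : 'cV[R]_n)
    (lambda mu : R) (bhat : 'cV[R]_p) : Prop :=
  forall b : 'cV[R]_p,
    slasso_objective X Y lambda mu bhat <= slasso_objective X Y lambda mu b.

(* Not satisfiable for n <= 1 when 0 < p, so it is to be required for 2 <= n. *)
Definition standardized n p (X : 'M[R]_(n, p)) : Prop :=
  forall j : 'I_p,
    n%:R^-1 * \sum_(i < n) X i j ^+ 2 = 1 /\ n%:R^-1 * \sum_(i < n) X i j = 0.

Definition gram n p (X : 'M[R]_(n, p)) : 'M[R]_p := n%:R^-1 *: (X^T *m X).

Definition posdefmx p (C : 'M[R]_p) : Prop :=
  C^T = C /\ forall v : 'cV[R]_p, v != 0 -> 0 < (v^T *m C *m v) 0 0.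

Definition active p (b : 'cV[R]_p) : {set 'I_p} :=
  [set j | b j 0 != 0]%SET.

(* Submatrices and subvectors are indexed by 'I_#|B|, the elements of B being
   listed in increasing order by enum_val. *)
Definition submx_of p (B B' : {set 'I_p}) (M : 'M[R]_p) : 'M[R]_(#|B|, #|B'|) :=
  mxsub enum_val enum_val M.

Definition subrow_of p (j : 'I_p) (B : {set 'I_p}) (M : 'M[R]_p) :
    'rV[R]_#|B| :=
  colsub enum_val (row j M).

Definition subvec_of p (B : {set 'I_p}) (b : 'cV[R]_p) : 'cV[R]_#|B| :=
  rowsub enum_val b.

Definition Sgn p (b : 'cV[R]_p) : 'cV[R]_p := map_mx Num.sg b.

Lemma Jtilde_sym p : (Jtilde p)^T = Jtilde p.
Proof.
apply/matrixP => j k; rewrite !mxE eq_sym orbC.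
by case: eqP => // ->.
Qed.

Lemma Jtilde_fusion p (b : 'cV[R]_p) :
  (b^T *m Jtilde p *m b) 0 0 = fusion b.
Proof.
pose K (j k : 'I_p) : R := (k == j.+1 :> nat)%:R.
have Kr (j : 'I_p) : \sum_k K j k = (j.+1 < p)%N%:R.
  have [jp|pj] := ltnP j.+1 p.
    rewrite (bigD1 (Ordinal jp))//= /K eqxx big1 ?addr0// => k kj.
    by case: eqP => // kE; case/eqP: kj; exact: val_inj.
  rewrite big1// => k _; rewrite /K; case: eqP => // kE.
  by move: (ltn_ord k); rewrite kE ltnNge pj.
have Kl (k : 'I_p) : \sum_j K j k = (0 < k)%N%:R.
  have [k0|] := posnP k; first by rewrite big1// => j _; rewrite /K k0.
  case: k => -[//|k] kp _ /=.
  rewrite (bigD1 (Ordinal (ltnW kp)))//= /K eqxx big1 ?addr0// => j jk.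
  by case: eqP => //= -[kE]; case/eqP: jk; exact: val_inj.
have JE j k :
    Jtilde p j k = (j == k)%:R * (\sum_i K i j + \sum_i K j i) - K j k - K k j.
  rewrite mxE Kl Kr /K; have [<-|jk] := eqVneq j k.
    by rewrite (ltn_eqF (ltnSn j)) mul1r !subr0.
  rewrite mul0r sub0r; have [kE|_] := eqVneq (k : nat) j.+1.
    by rewrite kE (@ltn_eqF j j.+2) ?subr0// ltnW.
  by rewrite oppr0 add0r; case: eqP => _ /=; rewrite ?oppr0.
rewrite /fusion; under eq_bigl do rewrite -[_ == _]andTb.
rewrite -(pair_big_dep xpredT (fun j k : 'I_p => k == j.+1 :> nat)
  (fun j k => (b k 0 - b j 0) ^+ 2)) /=.
transitivity (\sum_j \sum_k K j k * (b k 0 - b j 0) ^+ 2); last first.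
  apply: eq_bigr => j _; rewrite [RHS]big_mkcond; apply: eq_bigr => k _.
  by rewrite /K; case: eqP; rewrite ?mul1r ?mul0r.
transitivity (\sum_k \sum_j b j 0 * Jtilde p j k * b k 0).
  rewrite mxE; apply: eq_bigr => k _; rewrite mxE mulr_suml.
  by apply: eq_bigr => j _; rewrite mxE.
rewrite exchange_big /=.
have dg : \sum_j \sum_k (j == k)%:R
      * (b j 0 * (\sum_i K i j + \sum_i K j i) * b k 0) =
    \sum_j \sum_k K j k * b k 0 ^+ 2 + \sum_j \sum_k K j k * b j 0 ^+ 2.
  rewrite [X in _ = X + _]exchange_big -big_split /=.
  apply: eq_bigr => j _; rewrite -!mulr_suml (bigD1 j)//= eqxx.
  rewrite [X in _ + X = _]big1 => [|k kj]; first by rewrite mul1r; ring.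
  by rewrite eq_sym (negbTE kj) mul0r.
transitivity (\sum_j \sum_k K j k * b k 0 ^+ 2
    + \sum_j \sum_k K j k * b j 0 ^+ 2
    - \sum_j \sum_k K j k * (b j 0 * b k 0)
    - \sum_j \sum_k K j k * (b j 0 * b k 0)).
  rewrite -dg [X in _ - X]exchange_big /= -!sumrB; apply: eq_bigr => j _.
  by rewrite -!sumrB; apply: eq_bigr => k _; rewrite JE; ring.
rewrite -big_split -!sumrB; apply: eq_bigr => j _.
by rewrite -big_split -!sumrB; apply: eq_bigr => k _ /=; ring.
Qed.

End Deterministic.

Section Probabilistic.
Context d (T : measurableType d) (R : realType) (P : probability T R).

Definition mutually_independent (I : finType) (X : I -> {RV P >-> R}) : Prop :=
  forall (B : {set I}) (E : I -> set R),
    (forall i, i \in B -> measurable (E i)) ->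
    P (\bigcap_(i in [set` B]) X i @^-1` E i) =
    (\prod_(i in B) P (X i @^-1` E i))%E.

(* N(0, sigma ^ 2): the second parameter of normal_prob is the standard
   deviation. *)
Definition iid_gaussian (I : finType) (X : I -> {RV P >-> R}) (sigma : R) :
    Prop :=
  mutually_independent X /\
  forall (i : I) (E : set R), measurable E ->
    distribution P (X i) E = normal_prob 0 sigma E.

Definition random_vector p (V : T -> 'cV[R]_p) : Prop :=
  forall j : 'I_p, measurable_fun setT (fun w => V w j 0).

(* `|_| is the sup norm of column vectors; all norms are equivalent as p does
   not vary with n. *)
Definition cvg_in_probability p (V : nat -> T -> 'cV[R]_p) (v : 'cV[R]_p) :
    Prop :=
  forall e : R, 0 < e ->
    P [set w | e <= `|V n w - v|] @[n --> \oo] --> 0%E.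

End Probabilistic.

(* Main.v *)
From HB Require Import structures.
Require Import Defs.
From mathcomp Require Import all_boot all_order all_algebra ring lra.
From mathcomp Require Import all_classical all_reals all_analysis.
From mathcomp Require Import measurable_realfun.
Import Order.TTheory GRing.Theory Num.Theory.
Import numFieldNormedType.Exports.
Local Open Scope classical_set_scope.
Local Open Scope ring_scope.

(** The argument compares the optimality condition at an inactive index j with
    the symmetry of the noise.

    Write A for the support of bstar, C_n for the Gram matrix and J for the
    fusion matrix. On the event that bhat has support A and the signs of bstar,
    the optimality conditions on A are equalities ([slasso_kkt_active]). They
    are linear in D = bhat - bstar, which vanishes outside A, and are solved by
    the inverse of C_n + mu_n J restricted to A. The condition at j is an
    inequality ([slasso_kkt_inactive]); inserting D turns it into
      | N - lambda_n B_n + mu_n (J D)_j | <= lambda_n / 2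
    ([slasso_selected]), where N is a linear form in the noise and B_n is the
    quantity between bars in the theorem, taken at C_n, mu_n and
    mu_n / lambda_n. By continuity of matrix inversion, B_n tends to that
    quantity B ([cvg_selection_bias]).

    Nothing is known about the size of N / lambda_n. However, the law of the
    noise vector is invariant under negation, so N <= 0 and N >= 0 each have
    probability at least 1 / 2 ([iid_gaussian_halfspace]), whatever the design.
    The event that the support is right and bhat is close to bstar has
    probability tending to 1, so for large n it contains an outcome at which N
    has the sign that does not help to compensate B_n ([near_common_point]).
    There | B_n | <= 1 / 2 + (mu_n / lambda_n) | (J D)_j |, with D as small as
    desired. Letting n tend to infinity, and then the bound on D to 0, gives
    | B | <= 1 / 2 ([selection_bias_le_half]). *)

Set Implicit Arguments.
Unset Strict Implicit.
Unset Printing Implicit Defensive.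

(** * Linear forms in symmetric independent variables *)

(** The density is even and Lebesgue measure is invariant under negation; for
    s = 0 the distribution degenerates by convention to the uniform one on
    [0, 1], which is not symmetric. *)
Lemma normal_probN (R : realType) (s : R) (E : set R) : s != 0 ->
  measurable E -> normal_prob 0 s (-%R @^-1` E) = normal_prob 0 s E.
Proof.
move=> s0 mE; rewrite /normal_prob.
transitivity (\int[lebesgue_measure]_(x in -%R @^-1` E)
    (((fun x : measurableTypeR R => (normal_pdf 0 s x)%:E) \o
      (-%R : measurableTypeR R -> measurableTypeR R)) x))%E.
  apply: eq_integral => x _ /=; rewrite !normal_pdfE// /normal_fun.
  by rewrite !subr0 sqrrN.
have mN : measurable_fun setT (-%R : measurableTypeR R -> measurableTypeR R).
  exact: oppr_measurable.
rewrite -(ge0_integral_pushforward mN)//=.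
- by apply: eq_measure_integral => //= A mA _; exact: lebesgue_measureN.
- apply/measurable_EFinP/measurable_funTS.
  exact: measurable_normal_pdf.
- by move=> x _; rewrite lee_fin normal_pdf_ge0.
Qed.

(** The measurable rectangles generate the product sigma-algebra on I -> R and
    are stable under intersection, so they determine a joint law. *)
Definition rectangles (R : realType) (I : finType) : set (set (I -> R)) :=
  [set B | exists2 E : I -> set R, (forall i, measurable (E i)) &
    B = [set f | forall i, E i (f i)]].

Lemma measurable_to_rectangles d (T : measurableType d) (R : realType)
    (I : finType) (X : I -> T -> R) :
  (forall i, measurable_fun setT (X i)) ->
  measurable_fun setT
    ((fun w i => X i w) : T -> g_sigma_algebraType (@rectangles R I)).
Proof.
move=> mX; apply: measurability => // _ [_ [E mE ->] <-].
rewrite setTI (_ : _ @^-1` _ = \bigcap_(i in [set: I]) (X i @^-1` E i));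
  last first.
  by apply/seteqP; split=> w /= h i => [_|]; exact: h.
apply: fin_bigcap_measurable => // i _.
by rewrite -[X in measurable X]setTI; exact: mX.
Qed.

Lemma coordinate_measurable (R : realType) (I : finType) (i : I) :
  measurable_fun setT
    ((fun f => f i) : g_sigma_algebraType (@rectangles R I) -> R).
Proof.
move=> _ E mE; rewrite setTI; apply: sub_sigma_algebra.
exists (fun k => if k == i then E else setT).
  by move=> k; case: ifP.
apply/seteqP; split=> f /=.
  by move=> Efi k; case: eqP => [->|].
by move/(_ i); rewrite eqxx.
Qed.

Lemma rectangles_setI (R : realType) (I : finType) :
  setI_closed (@rectangles R I).
Proof.
move=> _ _ [E mE ->] [F mF ->]; exists (fun i => E i `&` F i).
  by move=> i; exact: measurableI.
apply/seteqP; split=> f /=; first by move=> [Ef Ff] i.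
by move=> EFf; split=> i; have [] := EFf i.
Qed.

Section SymmetricLaw.
Context d (T : measurableType d) (R : realType) (P : probability T R).

(** By independence, the joint laws of X and of - X give a rectangle the same
    mass, namely the product of the masses of its sides; two probability
    measures that agree on a generating pi-system are equal. *)
Lemma independent_symmetric_law (I : finType) (X : I -> {RV P >-> R})
    (hX : mutually_independent X)
    (hsym : forall i (E : set R), measurable E ->
       P (X i @^-1` (-%R @^-1` E)) = P (X i @^-1` E))
  (B : set (g_sigma_algebraType (@rectangles R I))) : measurable B ->
  P ((fun w i => - X i w) @^-1` B) = P ((fun w i => X i w) @^-1` B).
Proof.
pose RI := g_sigma_algebraType (@rectangles R I).
pose phi : T -> RI := fun w i => X i w.
pose psi : T -> RI := fun w i => - X i w.
have mphi : measurable_fun setT phi by apply: measurable_to_rectangles.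
have mpsi : measurable_fun setT psi.
  by apply: measurable_to_rectangles => i; exact: measurableT_comp.
pose Phi : {mfun T >-> RI} :=
  HB.pack phi (isMeasurableFun.Build _ _ _ _ phi mphi).
pose Psi : {mfun T >-> RI} :=
  HB.pack psi (isMeasurableFun.Build _ _ _ _ psi mpsi).
move=> mB; change (distribution P Psi B = distribution P Phi B).
apply: (@measure_unique _ R RI (@rectangles R I) (fun=> setT) erefl _ _ _
  (distribution P Psi) (distribution P Phi)) => //.
- exact: rectangles_setI.
- by move=> _; exists (fun=> setT) => //; apply/seteqP; split.
- by rewrite bigcup_const.
- move=> _ [E mE ->]; rewrite /distribution /pushforward /=.
  have rE (F : I -> set R) : (forall i, measurable (F i)) ->
      P [set w | forall i, F i (X i w)] = (\prod_i P (X i @^-1` F i))%E.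
    move=> mF; have := hX [set: I]%SET F (fun i _ => mF i).
    under [in X in _ = X -> _]eq_bigl do rewrite finset.in_setT.
    move=> <-; congr (P _); apply/seteqP; split=> w /= h i => [_|].
      exact: h.
    by apply: h; rewrite /= finset.in_setT.
  rewrite [RHS](rE E)// [LHS](rE (fun i => -%R @^-1` E i)).
    by apply: eq_bigr => i _; exact: hsym.
  move=> i; rewrite -[X in measurable X]setTI.
  exact: oppr_measurable.
- by move=> _; rewrite (le_lt_trans (probability_le1 _ _)) ?ltry.
Qed.

(** The half-spaces c . X <= 0 and c . X >= 0 are exchanged by X |-> - X, hence
    equally likely, and together they cover the whole space. *)
Lemma independent_symmetric_halfspace (I : finType) (X : I -> {RV P >-> R})
    (hX : mutually_independent X)
    (hsym : forall i (E : set R), measurable E ->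
       P (X i @^-1` (-%R @^-1` E)) = P (X i @^-1` E))
    (c : I -> R) :
  ((2^-1)%:E <= P [set w | (\sum_i c i * X i w <= 0)%R])%E.
Proof.
pose l (f : g_sigma_algebraType (@rectangles R I)) := \sum_i c i * f i.
have ml : measurable_fun setT l.
  apply: measurable_sum => i; apply: measurable_funM => //.
  exact: coordinate_measurable.
have mS : measurable_fun setT (fun w => \sum_i c i * X i w).
  by apply: measurable_sum => i; apply: measurable_funM.
have mle0 : measurable [set w | \sum_i c i * X i w <= 0].
  rewrite -[X in measurable X]setTI.
  exact: (mS measurableT `]-oo, 0]%classic).
have mge0 : measurable [set w | 0 <= \sum_i c i * X i w].
  have -> : [set w | 0 <= \sum_i c i * X i w] =
      [set: T] `&` (fun w => \sum_i c i * X i w) @^-1` `[0, +oo[.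
    by rewrite setTI; apply/seteqP; split=> w /=; rewrite in_itv/= andbT.
  exact: mS.
have sym : P [set w | \sum_i c i * X i w <= 0] =
    P [set w | 0 <= \sum_i c i * X i w].
  rewrite -[LHS](@independent_symmetric_law _ _ hX hsym
    (l @^-1` `]-oo, 0]%classic)).
    have lN w : l (fun i => - X i w) = - \sum_i c i * X i w.
      by rewrite -sumrN; apply: eq_bigr => i _; rewrite mulrN.
    by congr (P _); apply/seteqP; split=> w /=; rewrite lN in_itv/= oppr_le0.
  by rewrite -[X in measurable X]setTI; exact: ml.
have : (1%E <= P [set w | (\sum_i c i * X i w <= 0)%R]
    + P [set w | (\sum_i c i * X i w <= 0)%R])%E.
  rewrite {2}sym -(probability_setT P).
  apply: le_trans (measureU2 _ mle0 mge0).
  rewrite le_measure ?inE//; first exact: measurableU.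
  by move=> w _ /=; case: (leP (\sum_i c i * X i w) 0) => [|/ltW]; [left|right].
have /fineK <- := fin_num_measure P _ mle0.
by rewrite -EFinD !lee_fin; lra.
Qed.

Lemma iid_gaussian_halfspace (I : finType) (X : I -> {RV P >-> R})
    (sigma : R) (c : I -> R) : sigma != 0 -> iid_gaussian X sigma ->
  ((2^-1)%:E <= P [set w | (\sum_i c i * X i w <= 0)%R])%E.
Proof.
move=> s0 [Xind Xlaw]; apply: independent_symmetric_halfspace => // i E mE.
have mNE : measurable (-%R @^-1` E).
  by rewrite -[X in measurable X]setTI; exact: oppr_measurable.
by have := Xlaw i _ mNE; rewrite normal_probN// -(Xlaw i).
Qed.

End SymmetricLaw.

(** * Optimality conditions *)

Section Subgradient.
Context (R : realType).

(** First-order condition: the quadratic term is negligible against the linear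
    one as t tends to 0 from the right. *)
Lemma slope_ge0 (a q e : R) : 0 < e ->
  (forall t, 0 < t < e -> 0 <= t * a + t ^+ 2 * q) -> 0 <= a.
Proof.
move=> e0 h; rewrite leNgt; apply/negP => a0.
(* If a < 0, a step this small keeps t * q below - a / 2, so that the linear
   term dominates. *)
pose t := Num.min (e / 2) (- a / (2 * (`|q| + 1))).
have d0 : 0 < 2 * (`|q| + 1) by rewrite mulr_gt0// ltr_wpDl.
have t0 : 0 < t by rewrite lt_min !divr_gt0 ?oppr_gt0.
have te : t < e by rewrite gt_min; apply/orP; left; lra.
have tq : t * q <= - a / 2.
  have : t * (2 * (`|q| + 1)) <= - a by rewrite -ler_pdivlMr// ge_min lexx orbT.
  have := ler_norm q; have := normr_ge0 q; nra.
by have := h t; rewrite t0 te => /(_ isT); rewrite leNgt => /negP; apply; nra.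
Qed.

Lemma sqnormnE n (a : 'cV[R]_n) : sqnormn a = n%:R^-1 * (a^T *m a) 0 0.
Proof.
rewrite /sqnormn mxE; congr (_ * _); apply: eq_bigr => i _.
by rewrite mxE real_normK ?num_real// expr2.
Qed.

(** Half the gradient of the smooth part of the objective, that is, of the
    objective without its l1 term. *)
Definition half_gradient n p (X : 'M[R]_(n, p)) (Y : 'cV[R]_n) (mu : R)
    (b : 'cV[R]_p) : 'cV[R]_p :=
  gram X *m b - n%:R^-1 *: (X^T *m Y) + mu *: (Jtilde R p *m b).

Lemma dotmxC n (a b : 'cV[R]_n) : (a^T *m b) 0 0 = (b^T *m a) 0 0.
Proof. by rewrite -[b^T *m a]trmxK trmx_mul trmxK [RHS]mxE. Qed.

Lemma quadratic_form_line n (Q : 'M[R]_n) (b h : 'cV[R]_n) (t : R) :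
  Q^T = Q ->
  ((b + t *: h)^T *m Q *m (b + t *: h)) 0 0 =
  (b^T *m Q *m b) 0 0 + 2 * t * (h^T *m Q *m b) 0 0
  + t ^+ 2 * (h^T *m Q *m h) 0 0.
Proof.
move=> Qs; have bh : (b^T *m Q *m h) 0 0 = (h^T *m Q *m b) 0 0.
  by rewrite -mulmxA dotmxC trmx_mul Qs.
have -> : (b + t *: h)^T = b^T + t *: h^T.
  by apply/matrixP => i j; rewrite !mxE.
rewrite !mulmxDl !mulmxDr -!scalemxAl -!scalemxAr.
move: bh; set u1 := b^T *m _ *m h; set u2 := h^T *m _ *m b.
set u3 := b^T *m _ *m b; set u4 := h^T *m _ *m h.
by rewrite !mxE => ->; ring.
Qed.

Lemma slasso_objective_line n p (X : 'M[R]_(n, p)) (Y : 'cV[R]_n) (l mu : R)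
    (b h : 'cV[R]_p) (t : R) :
  slasso_objective X Y l mu (b + t *: h) =
  slasso_objective X Y l mu b
  + t * (2 * (h^T *m half_gradient X Y mu b) 0 0)
  + t ^+ 2 * (sqnormn (X *m h) + mu * fusion h)
  + l * (l1norm (b + t *: h) - l1norm b).
Proof.
rewrite /slasso_objective /half_gradient /gram !sqnormnE -!Jtilde_fusion.
set r := Y - X *m b.
have -> : Y - X *m (b + t *: h) = r + t *: - (X *m h).
  by rewrite mulmxDr -scalemxAr opprD addrA scalerN.
have -> : h^T *m (n%:R^-1 *: (X^T *m X) *m b - n%:R^-1 *: (X^T *m Y)
    + mu *: (Jtilde R p *m b)) =
    - n%:R^-1 *: ((X *m h)^T *m r) + mu *: (h^T *m Jtilde R p *m b).
  rewrite mulmxDr mulmxBr /r mulmxBr trmx_mul -!scalemxAl -!scalemxAr !mulmxA.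
  by rewrite scaleNr scalerBr opprB.
have rh : ((r + t *: - (X *m h))^T *m (r + t *: - (X *m h))) 0 0 =
    (r^T *m r) 0 0 - 2 * t * ((X *m h)^T *m r) 0 0
    + t ^+ 2 * ((X *m h)^T *m (X *m h)) 0 0.
  have := quadratic_form_line r (- (X *m h)) t (trmx1 R n).
  rewrite !mulmx1 => ->; have -> : (- (X *m h))^T = - (X *m h)^T.
    by apply/matrixP => i j; rewrite !mxE.
  rewrite !mulNmx mulmxN opprK; congr (_ + _ + _).
  by rewrite [X in _ * X]mxE mulrN.
rewrite rh (quadratic_form_line _ _ _ (Jtilde_sym R p)).
set u1 := _ *m r; set u2 := h^T *m _ *m b.
rewrite !mxE; ring.
Qed.

Lemma l1norm_coord p (b : 'cV[R]_p) (j : 'I_p) (t : R) :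
  l1norm (b + t *: delta_mx j 0) - l1norm b = `|b j 0 + t| - `|b j 0|.
Proof.
rewrite /l1norm -sumrB (bigD1 j)//= big1 ?addr0.
  by rewrite !mxE !eqxx mulr1.
by move=> k kj; rewrite !mxE (negbTE kj) mulr0 addr0 subrr.
Qed.

(** Moving the minimizer by t in the j-th coordinate cannot decrease the
    objective. The curvature q of the smooth part is left abstract because only
    small t matter. *)
Lemma slasso_coord_ge0 n p (X : 'M[R]_(n, p)) (Y : 'cV[R]_n) (l mu : R)
    (b : 'cV[R]_p) (j : 'I_p) : is_slasso X Y l mu b ->
  exists q, forall t,
    0 <= t * (2 * half_gradient X Y mu b j 0) + t ^+ 2 * q
      + l * (`|b j 0 + t| - `|b j 0|).
Proof.
move=> hb.
exists (sqnormn (X *m delta_mx j 0) + mu * fusion (delta_mx j 0)) => t.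
have := hb (b + t *: delta_mx j 0).
rewrite slasso_objective_line l1norm_coord trmx_delta -rowE [row _ _ _ _]mxE.
by lra.
Qed.

(** Both one-sided first-order conditions at the kink of the absolute value. *)
Lemma slasso_kkt_inactive n p (X : 'M[R]_(n, p)) (Y : 'cV[R]_n) (l mu : R)
    (b : 'cV[R]_p) (j : 'I_p) : is_slasso X Y l mu b -> b j 0 = 0 ->
  `|half_gradient X Y mu b j 0| <= l / 2.
Proof.
move=> /slasso_coord_ge0 - /(_ j)[q hq] bj0; rewrite bj0 in hq.
set g := half_gradient _ _ _ _ _ _ in hq *.
have h1 : 0 <= 2 * g + l.
  apply: (@slope_ge0 _ q 1) => // t /andP[t0 _]; have := hq t.
  by rewrite add0r normr0 subr0 gtr0_norm//; lra.
have h2 : 0 <= - (2 * g) + l.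
  apply: (@slope_ge0 _ q 1) => // t /andP[t0 _]; have := hq (- t).
  by rewrite add0r normr0 subr0 normrN gtr0_norm// sqrrN; lra.
by rewrite ler_norml; apply/andP; split; lra.
Qed.

(** Away from 0 the absolute value is locally affine, and the two one-sided
    conditions combine into an equality. *)
Lemma slasso_kkt_active n p (X : 'M[R]_(n, p)) (Y : 'cV[R]_n) (l mu : R)
    (b : 'cV[R]_p) (j : 'I_p) : is_slasso X Y l mu b -> b j 0 != 0 ->
  half_gradient X Y mu b j 0 = - (l / 2 * Num.sg (b j 0)).
Proof.
move=> /slasso_coord_ge0 - /(_ j)[q hq] bj0.
set g := half_gradient _ _ _ _ _ _ in hq *.
set x := b j 0 in hq bj0 *.
have x0 : 0 < `|x| by rewrite normr_gt0.
have sgx t : `|t| < `|x| -> `|x + t| - `|x| = Num.sg x * t.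
  have [x00|xp|xn] := sgrP x; first by rewrite x00 eqxx in bj0.
  - by rewrite ltr_norml => /andP[? ?]; rewrite ger0_norm; lra.
  - by rewrite ltr_norml => /andP[? ?]; rewrite ler0_norm; lra.
have h1 : 0 <= 2 * g + l * Num.sg x.
  apply: (@slope_ge0 _ q `|x|) => // t /andP[t0 tx]; have := hq t.
  by rewrite sgx ?(gtr0_norm t0)//; lra.
have h2 : 0 <= - (2 * g + l * Num.sg x).
  apply: (@slope_ge0 _ q `|x|) => // t /andP[t0 tx]; have := hq (- t).
  by rewrite sgx ?normrN ?(gtr0_norm t0)// sqrrN; lra.
lra.
Qed.

End Subgradient.

(** * Limits of matrices *)

Section Continuity.
Context (R : realType).

Lemma cvg_mx (T : Type) (F : set_system T) {FF : Filter F} m n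
    (M : T -> 'M[R]_(m, n)) (N : 'M[R]_(m, n)) :
  (forall i j, M t i j @[t --> F] --> N i j) -> M t @[t --> F] --> N.
Proof.
move=> MN A [B NB BA].
have : \forall t \near F, forall i j, B i j (M t i j).
  by apply: filter_forall => i; apply: filter_forall => j; exact: MN.
by apply: filterS => t; exact: BA.
Qed.

Lemma cvg_mx_coord (T : Type) (F : set_system T) {FF : Filter F} m n
    (M : T -> 'M[R]_(m, n)) (N : 'M[R]_(m, n)) i j :
  M t @[t --> F] --> N -> M t i j @[t --> F] --> N i j.
Proof.
move=> MN.
apply: (@cvg_comp _ _ _ M (fun A : 'M[R]_(m, n) => A i j) _ _ _ MN).
exact: coord_continuous.
Qed.

Lemma cvg_mxsub (T : Type) (F : set_system T) {FF : Filter F} m n m' n'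
    (f : 'I_m' -> 'I_m) (g : 'I_n' -> 'I_n)
    (M : T -> 'M[R]_(m, n)) (N : 'M[R]_(m, n)) :
  M t @[t --> F] --> N -> mxsub f g (M t) @[t --> F] --> mxsub f g N.
Proof.
move=> MN; apply: cvg_mx => i j; rewrite mxE.
by under eq_fun do rewrite mxE; exact: cvg_mx_coord.
Qed.

Lemma cvg_mulmx (T : Type) (F : set_system T) {FF : Filter F} m n q
    (M : T -> 'M[R]_(m, n)) (M' : T -> 'M[R]_(n, q))
    (N : 'M[R]_(m, n)) (N' : 'M[R]_(n, q)) :
  M t @[t --> F] --> N -> M' t @[t --> F] --> N' ->
  M t *m M' t @[t --> F] --> N *m N'.
Proof.
move=> MN MN'; apply: cvg_mx => i k; rewrite mxE.
under eq_fun do rewrite mxE.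
apply: cvg_big; first exact: add_continuous.
by move=> j _; apply: cvgM; exact: cvg_mx_coord.
Qed.

Lemma cvg_det (T : Type) (F : set_system T) {FF : Filter F} n
    (M : T -> 'M[R]_n) (N : 'M[R]_n) :
  M t @[t --> F] --> N -> \det (M t) @[t --> F] --> \det N.
Proof.
move=> MN; apply: cvg_big; first exact: add_continuous.
move=> s _; apply: cvgM; first exact: cvg_cst.
apply: cvg_big; first exact: mul_continuous.
by move=> i _; exact: cvg_mx_coord.
Qed.

Lemma cvg_adjugate (T : Type) (F : set_system T) {FF : Filter F} n
    (M : T -> 'M[R]_n) (N : 'M[R]_n) :
  M t @[t --> F] --> N -> \adj (M t) @[t --> F] --> \adj N.
Proof.
move=> MN; apply: cvg_mx => i j; rewrite mxE.
under eq_fun do rewrite mxE.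
apply: cvgM; first exact: cvg_cst.
apply: cvg_det; apply: cvg_mx => k l; rewrite !mxE.
by under eq_fun do rewrite !mxE; exact: cvg_mx_coord.
Qed.

Lemma cvg_near_unitmx (T : Type) (F : set_system T) {FF : Filter F} n
    (M : T -> 'M[R]_n) (N : 'M[R]_n) :
  N \in unitmx -> M t @[t --> F] --> N -> \forall t \near F, M t \in unitmx.
Proof.
rewrite unitmxE unitfE => detN MN.
have : \forall t \near F, \det (M t) != 0.
  by apply: (cvgr_neq0 (\det N)) => //; exact: cvg_det.
by apply: filterS => t; rewrite unitmxE unitfE.
Qed.

(** The inverse is the adjugate divided by the determinant as soon as the
    latter is nonzero, which holds eventually. *)
Lemma cvg_invmx (T : Type) (F : set_system T) {FF : Filter F} n
    (M : T -> 'M[R]_n) (N : 'M[R]_n) :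
  N \in unitmx -> M t @[t --> F] --> N -> invmx (M t) @[t --> F] --> invmx N.
Proof.
move=> Nu MN; rewrite /invmx Nu.
apply: cvg_trans (near_eq_cvg _) (cvgZ (cvgV _ (cvg_det MN)) (cvg_adjugate MN)).
  near=> t; rewrite (_ : M t \in unitmx)//; near: t.
  exact: cvg_near_unitmx Nu MN.
by rewrite -unitfE -unitmxE.
Unshelve. all: by end_near. Qed.

End Continuity.

(** * Elimination of the estimation error on the support *)

Section Selection.
Context (R : realType).

(** Left multiplication by this matrix restricts to A and its transpose extends
    by 0 outside A, so that restrictions of vectors and matrices become
    matrix products. *)
Definition selmx p (A : {set 'I_p}) : 'M[R]_(#|A|, p) := rowsub enum_val 1%:M.

Lemma subvec_ofE p (A : {set 'I_p}) (b : 'cV[R]_p) :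
  subvec_of A b = selmx A *m b.
Proof. by rewrite /selmx mul_rowsub_mx mul1mx. Qed.

Lemma subrow_ofE p (A : {set 'I_p}) (M : 'M[R]_p) j :
  subrow_of j A M = row j M *m (selmx A)^T.
Proof.
by rewrite /selmx trmx_mxsub trmx1 mulmx_colsub mulmx1.
Qed.

Lemma submx_ofE p (A : {set 'I_p}) (M : 'M[R]_p) :
  submx_of A A M = selmx A *m M *m (selmx A)^T.
Proof.
rewrite /selmx trmx_mxsub trmx1 mul_rowsub_mx mul1mx mulmx_colsub mulmx1.
by rewrite -mxsub_comp.
Qed.

Lemma selmxK p (A : {set 'I_p}) : selmx A *m (selmx A)^T = 1%:M.
Proof.
rewrite -{1}[selmx A]mulmx1 -submx_ofE; apply/matrixP => i k.
by rewrite !mxE (inj_eq enum_val_inj).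
Qed.

Lemma selmx_supported p (A : {set 'I_p}) (b : 'cV[R]_p) :
  (forall k, k \notin A -> b k 0 = 0) -> (selmx A)^T *m (selmx A *m b) = b.
Proof.
move=> b0; rewrite -subvec_ofE; apply/matrixP => k i; rewrite ord1 mxE.
under eq_bigr do rewrite !mxE.
rewrite -(big_enum_val (fun m : 'I_p => (m == k)%:R * b m 0)) /=.
have [kA|kA] := boolP (k \in A).
  rewrite (bigD1 k)//= eqxx mul1r big1 ?addr0// => m /andP[_ /negbTE->].
  by rewrite mul0r.
rewrite b0// big1// => m mA; case: eqP => [mk|_]; last by rewrite mul0r.
by rewrite -mk mA in kA.
Qed.

Lemma posdef_unitmx n (M : 'M[R]_n) :
  (forall v : 'cV[R]_n, v != 0 -> 0 < (v^T *m M *m v) 0 0) -> M \in unitmx.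
Proof.
move=> Mpos; rewrite -row_free_unit; apply: inj_row_free => v vM.
apply/eqP/negPn/negP => v0.
have := Mpos v^T; rewrite trmxK vM mul0mx mxE ltxx => h.
suff /h : v^T != 0 by [].
by apply: contra v0 => /eqP v0; rewrite -[v]trmxK v0 trmx0.
Qed.

(** A principal submatrix of a positive definite matrix is positive definite,
    because the vectors on A embed by 0 into the whole space, and the fusion
    penalty only adds a nonnegative quadratic form. *)
Lemma penalized_gram_unitmx p (A : {set 'I_p}) (C : 'M[R]_p) (mu : R) :
  posdefmx C -> 0 <= mu ->
  submx_of A A C + mu *: submx_of A A (Jtilde R p) \in unitmx.
Proof.
move=> [_ Cpos] mu0; apply: posdef_unitmx => v v0; rewrite !submx_ofE.
set z := (selmx A)^T *m v.
have zE (M : 'M[R]_p) :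
    v^T *m (selmx A *m M *m (selmx A)^T) *m v = z^T *m M *m z.
  by rewrite /z trmx_mul trmxK !mulmxA.
have z0 : z != 0.
  apply: contra v0 => /eqP z0.
  by rewrite -[v]mul1mx -(selmxK A) -mulmxA -/z z0 mulmx0.
rewrite mulmxDr mulmxDl -scalemxAr -scalemxAl !zE [X in _ < X]mxE.
rewrite [X in _ < _ + X]mxE Jtilde_fusion.
by rewrite ltr_pwDl ?Cpos// mulr_ge0// sumr_ge0// => i _; exact: sqr_ge0.
Qed.

(** Let C be the Gram matrix, mu the fusion parameter, l the l1 parameter and
    g = mu / l. For an S-Lasso solution with support A and the signs of b, the
    j-th half gradient is a linear form in the noise, minus l times this bias,
    plus a fusion term in the estimation error. *)
Definition selection_bias p (A : {set 'I_p}) (j : 'I_p) (b : 'cV[R]_p)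
    (C : 'M[R]_p) (mu g : R) : R :=
  (subrow_of j A C
     *m invmx (submx_of A A C + mu *: submx_of A A (Jtilde R p))
     *m (2^-1 *: Sgn (subvec_of A b)
         + g *: (submx_of A A (Jtilde R p) *m subvec_of A b))
   - g *: (subrow_of j A (Jtilde R p) *m subvec_of A b)) 0 0.

(** The coefficients of the noise in the j-th half gradient, after the
    estimation error on A has been eliminated. *)
Definition noise_weight n p (A : {set 'I_p}) (j : 'I_p) (X : 'M[R]_(n, p))
    (mu : R) : 'rV[R]_n :=
  n%:R^-1 *: ((subrow_of j A (gram X)
     *m invmx (submx_of A A (gram X) + mu *: submx_of A A (Jtilde R p))
     *m selmx A - row j 1%:M) *m X^T).

Lemma half_gradient_error n p (X : 'M[R]_(n, p)) (bstar b : 'cV[R]_p)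
    (e : 'cV[R]_n) (mu : R) :
  half_gradient X (X *m bstar + e) mu b =
  gram X *m (b - bstar) - n%:R^-1 *: (X^T *m e) + mu *: (Jtilde R p *m b).
Proof.
rewrite /half_gradient /gram mulmxDr mulmxBr scalerDr opprD addrA.
by rewrite -!scalemxAl !mulmxA.
Qed.

(** When the support and the signs are recovered, the optimality conditions on
    A form a linear system for the estimation error on A. Its solution,
    inserted into the condition at an inactive j, leaves the noise, the bias
    and the fusion term of the estimation error. *)
Lemma slasso_selected n p (X : 'M[R]_(n, p)) (bstar b : 'cV[R]_p)
    (e : 'cV[R]_n) (l mu : R) (j : 'I_p) :
  let A := active bstar in
  is_slasso X (X *m bstar + e) l mu b -> 0 < l ->
  active b = A -> Sgn b = Sgn bstar -> j \notin A ->
  submx_of A A (gram X) + mu *: submx_of A A (Jtilde R p) \in unitmx ->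
  `| (noise_weight A j X mu *m e) 0 0
     - l * selection_bias A j bstar (gram X) mu (mu / l)
     + mu * (subrow_of j A (Jtilde R p) *m subvec_of A (b - bstar)) 0 0 |
  <= l / 2.
Proof.
move=> A bmin l0 bA bsgn jA Mu.
have out (x : 'cV[R]_p) : active x = A -> forall k, k \notin A -> x k 0 = 0.
  by move=> <- k; rewrite finset.inE negbK => /eqP.
have inb k : k \in A -> b k 0 != 0 by rewrite -bA finset.inE.
have := slasso_kkt_inactive bmin (out _ bA _ jA).
set G := half_gradient _ _ _ _.
set W := n%:R^-1 *: (X^T *m e).
set S := selmx A; set J := Jtilde R p; set D := S *m (b - bstar).
have SD : S^T *m D = b - bstar.
  by apply: selmx_supported => k kA; rewrite !mxE (out b)// (out bstar)// subrr.
have Sb : S^T *m (S *m bstar + D) = b.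
  by rewrite mulmxDr SD selmx_supported; [rewrite addrC subrK|exact: out].
have GE : G = gram X *m S^T *m D - W + mu *: (J *m S^T *m (S *m bstar + D)).
  by rewrite /G half_gradient_error -!mulmxA SD Sb.
have SG : S *m G = - (l *: (2^-1 *: Sgn (S *m bstar))).
  rewrite -!subvec_ofE; apply/matrixP => i k; rewrite ord1.
  transitivity (G (enum_val i) 0); first by rewrite mxE.
  rewrite /G (slasso_kkt_active bmin) ?mxE; last first.
    exact: inb (enum_valP i).
  have /matrixP/(_ (enum_val i) 0) := bsgn; rewrite !mxE => ->.
  by rewrite mulrA.
set JA := submx_of A A J; set M := _ + mu *: JA in Mu.
set CjA := subrow_of j A (gram X); set JjA := subrow_of j A J.
have SG' : S *m G = M *m D + mu *: (JA *m (S *m bstar)) - S *m W.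
  rewrite GE !mulmxDr mulmxN -[S *m (mu *: _)]scalemxAr !mulmxDr scalerDr.
  rewrite mulmxDl -scalemxAl.
  rewrite /JA !submx_ofE -/S -/J !mulmxA.
  by rewrite addrAC [X in _ + X - _]addrC addrA.
have DE : D = invmx M *m (S *m W - l *: (2^-1 *: Sgn (S *m bstar))
    - mu *: (JA *m (S *m bstar))).
  by rewrite [S *m W - _]addrC -SG SG' subrK addrK mulKmx.
have rowS (Q : 'M[R]_p) (v : 'cV[R]_#|A|) :
    row j (Q *m S^T *m v) = subrow_of j A Q *m v.
  by rewrite subrow_ofE !row_mul.
have rowG : row j G = CjA *m D - row j W + mu *: (JjA *m (S *m bstar + D)).
  by rewrite GE -!rowS; apply/matrixP => i k; rewrite !mxE.
have noiseE :
    noise_weight A j X mu *m e = CjA *m invmx M *m (S *m W) - row j W.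
  rewrite /noise_weight -/M -/S -/CjA /W -scalemxAl mulmxBl mulmxBl scalerBr.
  rewrite -!mulmxA -row_mul mul1mx -!scalemxAr !mulmxA.
  by congr (_ - _); apply/matrixP => i k; rewrite !mxE.
suff -> : G j 0 = (noise_weight A j X mu *m e) 0 0
     - l * selection_bias A j bstar (gram X) mu (mu / l)
     + mu * (JjA *m subvec_of A (b - bstar)) 0 0 by [].
have -> : G j 0 = row j G 0 0 by rewrite [RHS]mxE.
rewrite rowG noiseE /selection_bias !subvec_ofE.
rewrite -/S -/D -/J -/M -/CjA -/JjA -/JA.
(* From here on W must not be unfolded by the rules on scalar factors. *)
clearbody W.
rewrite [in CjA *m D]DE !mulmxDr !mulmxN mulmxA -!scalemxAr !mulmxA.
set k1 := _ *m W; set k2 := _ *m Sgn _; set k3 := _ *m bstar.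
set k4 := JjA *m S *m bstar; set k5 := JjA *m D.
by rewrite !mxE; field; rewrite gt_eqF.
Qed.

End Selection.

Lemma cvg_selection_bias (R : realType) (T : Type) (F : set_system T)
    {FF : Filter F} p
    (A : {set 'I_p}) (j : 'I_p) (b : 'cV[R]_p)
    (Ct : T -> 'M[R]_p) (mut gt : T -> R) (C : 'M[R]_p) (mu g : R) :
  submx_of A A C + mu *: submx_of A A (Jtilde R p) \in unitmx ->
  Ct t @[t --> F] --> C -> mut t @[t --> F] --> mu -> gt t @[t --> F] --> g ->
  selection_bias A j b (Ct t) (mut t) (gt t) @[t --> F] -->
  selection_bias A j b C mu g.
Proof.
move=> Mu hC hmu hg; apply: cvg_mx_coord.
apply: cvgB; last by apply: cvgZ => //; exact: cvg_cst.
apply: cvg_mulmx; last first.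
  by apply: cvgD; [exact: cvg_cst|apply: cvgZ => //; exact: cvg_cst].
apply: cvg_mulmx; first by apply: cvg_mxsub; exact: cvg_mxsub.
apply: cvg_invmx => //; apply: cvgD; first exact: cvg_mxsub.
by apply: cvgZ => //; exact: cvg_cst.
Qed.

(** * Events of high probability *)

Lemma le_coord_mx_norm (R : realType) m n (M : 'M[R]_(m, n)) i j :
  `|M i j| <= `|M|.
Proof.
by rewrite [leRHS]/Num.norm /= mx_normrE; apply: (le_bigmax _ _ (i, j)).
Qed.

Lemma Sgn_near (R : realType) p (b bstar : 'cV[R]_p) (e : R) :
  active b = active bstar -> (forall k, bstar k 0 != 0 -> e <= `|bstar k 0|) ->
  `|b - bstar| < e -> Sgn b = Sgn bstar.
Proof.
move=> bA he be; apply/matrixP => k i; rewrite ord1 !mxE.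
have [bk0|bk0] := eqVneq (bstar k 0) 0.
  have : k \notin active b by rewrite bA finset.inE bk0 eqxx.
  by rewrite finset.inE negbK => /eqP ->; rewrite bk0.
have := le_lt_trans (le_coord_mx_norm (b - bstar) k 0)
  (lt_le_trans be (he _ bk0)).
rewrite !mxE; have [x0|xp|xn] := sgrP (bstar k 0).
  by rewrite x0 eqxx in bk0.
  by rewrite ltr_norml => /andP[? ?]; apply: gtr0_sg; lra.
by rewrite ltr_norml => /andP[? ?]; apply: ltr0_sg; lra.
Qed.

Section Events.
Context d (T : measurableType d) (R : realType) (P : probability T R).

(** Eventually P (~` E n) + P (F n) < c, so that H n cannot be covered by
    ~` E n and F n. *)
Lemma near_common_point (E F H : nat -> set T) (c : R) : 0 < c ->
  (forall n, measurable (E n)) -> (forall n, measurable (F n)) ->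
  (forall n, measurable (H n)) ->
  P (E n) @[n --> \oo] --> 1%E -> P (F n) @[n --> \oo] --> 0%E ->
  (forall n, (c%:E <= P (H n))%E) ->
  \forall n \near \oo, exists w, [/\ E n w, ~ F n w & H n w].
Proof.
move=> c0 mE mF mH PE PF PH.
have c3 : 0 < c / 3 by rewrite divr_gt0.
have PE' : \forall n \near \oo, 1 - c / 3 < fine (P (E n)).
  by move/fine_cvgP: PE => [_ /cvgr_gt]; apply; lra.
have PF' : \forall n \near \oo, fine (P (F n)) < c / 3.
  by move/fine_cvgP: PF => [_ /cvgr_lt]; apply; lra.
near=> n; apply/not_existsP => h.
have HEF : H n `<=` ~` E n `|` F n.
  move=> w Hw; have [Fw|nFw] := pselect (F n w); first by right.
  by left => Ew; apply: (h w).
have mEc := measurableC (mE n).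
have : (c%:E <= P (~` E n) + P (F n))%E.
  apply: le_trans (PH n) _; apply: le_trans (measureU2 _ mEc (mF n)).
  by rewrite le_measure ?inE//; exact: measurableU.
rewrite probability_setC//.
have : 1 - c / 3 < fine (P (E n)) by near: n.
have : fine (P (F n)) < c / 3 by near: n.
rewrite -(fineK (fin_num_measure P _ (mE n))).
rewrite -(fineK (fin_num_measure P _ (mF n))).
by rewrite -EFinB -EFinD lee_fin /=; lra.
Unshelve. all: by end_near. Qed.

Lemma measurable_active p (V : T -> 'cV[R]_p) (A : {set 'I_p}) :
  random_vector V -> measurable [set w | active (V w) = A].
Proof.
move=> mV.
have -> : [set w | active (V w) = A] = \bigcap_(k in [set: 'I_p])
    (fun w => V w k 0) @^-1` [set x | (x != 0) = (k \in A)].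
  apply/seteqP; split=> w /=; first by move=> <- k _ /=; rewrite finset.inE.
  by move=> h; apply/setP => k; rewrite finset.inE; exact: h.
apply: fin_bigcap_measurable => // k _; rewrite -[X in measurable X]setTI.
apply: mV => //; have [kA|kA] := boolP (k \in A).
  rewrite (_ : [set x | _] = ~` [set 0]); first exact: measurableC.
  by apply/seteqP; split=> x /=; case: eqP.
rewrite (_ : [set x | _] = [set 0])//.
by apply/seteqP; split=> x /=; case: eqP.
Qed.

Lemma measurable_deviation p (V : T -> 'cV[R]_p) (v : 'cV[R]_p) (e : R) :
  0 < e -> random_vector V -> measurable [set w | e <= `|V w - v|].
Proof.
move=> e0 mV.
have -> : [set w | e <= `|V w - v|] = \bigcup_(k in [set: 'I_p])
    (fun w => V w k 0 - v k 0) @^-1` [set x | e <= `|x|].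
  apply/seteqP; split=> w /=.
    rewrite [X in _ <= X]/Num.norm/= mx_normrE => /bigmax_geP[|[[k i] _]].
      by rewrite leNgt e0.
    by rewrite !mxE ord1 => ek; exists k.
  move=> [k _ /= ek]; apply: le_trans ek _.
  by have := le_coord_mx_norm (V w - v) k 0; rewrite !mxE.
apply: fin_bigcup_measurable => // k _; rewrite -[X in measurable X]setTI.
have mf : measurable_fun setT (fun w => `|V w k 0 - v k 0|).
  by apply: measurableT_comp => //; apply: measurable_funB.
rewrite (_ : _ @^-1` _ = (fun w => `|V w k 0 - v k 0|) @^-1` `[e, +oo[).
  exact: mf.
by apply/seteqP; split=> w /=; rewrite in_itv/= andbT.
Qed.

End Events.

(** * Necessity of the condition *)

Section Necessity.
Context (R : realType) (d : measure_display) (T : measurableType d)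
    (P : probability T R)
    (p : nat) (bstar : 'cV[R]_p) (sigma : R) (hsigma : 0 < sigma)
    (X : forall n : nat, 'M[R]_(n, p))
    (eps : forall n : nat, 'I_n -> {RV P >-> R})
    (heps : forall n : nat, iid_gaussian (eps n) sigma)
    (C : 'M[R]_p)
    (hC : gram (X n) @[n --> \oo] --> C) (hCpos : posdefmx C)
    (lambda mu_ : nat -> R)
    (hlambda : forall n : nat, 0 < lambda n) (hmu_ : forall n : nat, 0 < mu_ n)
    (mu gamma : R)
    (hmu : mu_ n @[n --> \oo] --> mu)
    (hgamma : mu_ n / lambda n @[n --> \oo] --> gamma)
    (bhat : nat -> T -> 'cV[R]_p)
    (hbhat_rv : forall n : nat, random_vector (bhat n))
    (hbhat : forall (n : nat) (w : T),
       is_slasso (X n) (X n *m bstar + \col_(i < n) eps n i w)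
         (lambda n) (mu_ n) (bhat n w))
    (hcons : cvg_in_probability P bhat bstar)
    (hsel : P [set w | active (bhat n w) = active bstar] @[n --> \oo] --> 1%E)
    (j : 'I_p) (hj : j \notin active bstar).

Let A := active bstar.
Let S := \sum_k `|subrow_of j A (Jtilde R p) 0 k|.

Let mu_ge0 : 0 <= mu.
Proof.
by apply: (ler_cvg_to (cvg_cst 0) hmu); apply: nearW => n; exact: ltW.
Qed.

(** Eventually some outcome has the right support, an estimation error below e
    and a noise term N with s * N <= 0. If s times the bias is positive, such
    a noise term pushes the j-th half gradient in the same direction as the
    bias does, so the optimality condition at j, divided by lambda n, bounds
    the bias; the estimation error costs at most gamma * (S * e) in the
    limit. *)
Lemma signed_selection_bias_le (s e : R) : s = 1 \/ s = -1 -> 0 < e ->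
  (forall k, bstar k 0 != 0 -> e <= `|bstar k 0|) ->
  s * selection_bias A j bstar C mu gamma <= 2^-1 + gamma * (S * e).
Proof.
move=> s1 e0 he.
have Mu := penalized_gram_unitmx A hCpos mu_ge0.
have L : selection_bias A j bstar (gram (X n)) (mu_ n) (mu_ n / lambda n)
    @[n --> \oo] --> selection_bias A j bstar C mu gamma.
  exact: cvg_selection_bias.
pose Q n := submx_of A A (gram (X n)) + mu_ n *: submx_of A A (Jtilde R p).
have Qcvg : Q n @[n --> \oo] -->
    submx_of A A C + mu *: submx_of A A (Jtilde R p).
  by apply: cvgD; [exact: cvg_mxsub|apply: cvgZ => //; exact: cvg_cst].
have Qu : \forall n \near \oo, Q n \in unitmx by exact: cvg_near_unitmx Mu Qcvg.
pose K n := s *: noise_weight A j (X n) (mu_ n).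
pose H n := [set w | \sum_i K n 0 i * @eps n i w <= 0].
have HE : \forall n \near \oo, exists w,
    [/\ [set w | active (bhat n w) = active bstar] w,
        ~ [set w | e <= `|bhat n w - bstar|] w & H n w].
  apply: (near_common_point (c := 2^-1) _ _ _ _ hsel (hcons e0)) => //.
  - by move=> n; exact: measurable_active.
  - by move=> n; exact: measurable_deviation.
  - move=> n; rewrite -[X in measurable X]setTI.
    have mS : measurable_fun setT (fun w => \sum_i K n 0 i * @eps n i w).
      by apply: measurable_sum => i; apply: measurable_funM.
    exact: (mS measurableT `]-oo, 0]%classic).
  - by move=> n; apply: (iid_gaussian_halfspace _ _ (heps n)); rewrite gt_eqF.
have Lcvg : s * selection_bias A j bstar (gram (X n)) (mu_ n) (mu_ n / lambda n)
    @[n --> \oo] --> s * selection_bias A j bstar C mu gamma.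
  exact: (cvgM (cvg_cst s) L).
have Ucvg : 2^-1 + (mu_ n / lambda n) * (S * e) @[n --> \oo] -->
    2^-1 + gamma * (S * e).
  by apply: cvgD; [exact: cvg_cst|exact: (cvgM hgamma (cvg_cst _))].
apply: (ler_cvg_to Lcvg Ucvg); near=> n.
have [w [/= wA /negP wD wH]] : exists w,
    [/\ [set w | active (bhat n w) = active bstar] w,
        ~ [set w | e <= `|bhat n w - bstar|] w & H n w] by near: n.
rewrite -ltNge in wD.
have Qn : Q n \in unitmx by near: n.
have l0 := hlambda n; have m0 := hmu_ n.
have := slasso_selected (hbhat n w) l0 wA (Sgn_near wA he wD) hj Qn.
set N := (noise_weight _ _ _ _ *m _) 0 0; set B := selection_bias _ _ _ _ _ _.
set r := (subrow_of _ _ _ *m _) 0 0.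
have sN : s * N <= 0.
  move: wH; rewrite /H /K /= => /(le_trans _); apply.
  rewrite /N mxE mulr_sumr le_eqVlt; apply/orP; left; apply/eqP.
  by apply: eq_bigr => i _; rewrite !mxE mulrA.
have rS : `|r| <= S * e.
  rewrite /r mxE /S mulr_suml; apply: le_trans (ler_norm_sum _ _ _) _.
  apply: ler_sum => k _; rewrite normrM ler_wpM2l//.
  rewrite mxE; apply: le_trans (ltW wD); exact: le_coord_mx_norm.
set g := mu_ n / lambda n; have g0 : 0 < g by rewrite divr_gt0.
have -> : mu_ n * r = lambda n * (g * r).
  by rewrite mulrA /g [lambda n * _]mulrC divfK ?gt_eqF.
have rg : `|g * r| <= g * (S * e) by rewrite normrM gtr0_norm// ler_pM2l.
move: rg; rewrite !ler_norml => /andP[r1 r2] /andP[h1 h2].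
(* The noise drops out because s * N <= 0. *)
have Bl : lambda n * (s * B) <= lambda n * (2^-1 + g * (S * e)).
  by case: s1 sN => ->; nra.
by rewrite ler_pM2l in Bl.
Unshelve. all: by end_near. Qed.

(** The radius e in the previous bound tends to 0. The constant is 1 / 2
    because differentiating the squared loss produces a factor 2 whereas the
    l1 norm carries lambda n alone. *)
Lemma selection_bias_le_half : `|selection_bias A j bstar C mu gamma| <= 2^-1.
Proof.
suff signed s : s = 1 \/ s = -1 ->
    s * selection_bias A j bstar C mu gamma <= 2^-1.
  rewrite ler_norml lerNl -mulN1r signed//; last by right.
  by rewrite -[X in X <= _]mul1r signed//; left.
move=> s1.
have U : 2^-1 + gamma * (S * e) @[e --> 0^'+] --> 2^-1 + gamma * (S * 0).
  apply: cvgD; first exact: cvg_cst.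
  apply: cvgM; first exact: cvg_cst.
  by apply: cvgM; [exact: cvg_cst|exact: cvg_at_right_filter].
rewrite !mulr0 addr0 in U.
apply: (ler_cvg_to (cvg_cst _) U); near=> e.
apply: signed_selection_bias_le => // k bk.
have : forall k : 'I_p, bstar k 0 != 0 -> e < `|bstar k 0|.
  near: e; apply: filter_forall => i.
  have [_|bi] := eqVneq (bstar i 0) 0; first exact: nearW.
  by near=> e => _; near: e; apply: nbhs_right_lt; rewrite normr_gt0.
by move=> /(_ k bk)/ltW.
Unshelve. all: by end_near. Qed.

End Necessity.

Unset Implicit Arguments.

Theorem theorem3 (R : realType) (d : measure_display) (T : measurableType d)
    (P : probability T R)
    (p : nat) (bstar : 'cV[R]_p) (sigma : R) (hsigma : 0 < sigma)
    (X : forall n : nat, 'M[R]_(n, p))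
    (hX : forall n : nat, (2 <= n)%N -> standardized (X n))
    (eps : forall n : nat, 'I_n -> {RV P >-> R})
    (heps : forall n : nat, iid_gaussian (eps n) sigma)
    (C : 'M[R]_p)
    (hC : gram (X n) @[n --> \oo] --> C) (hCpos : posdefmx C)
    (lambda mu_ : nat -> R)
    (hlambda : forall n : nat, 0 < lambda n) (hmu_ : forall n : nat, 0 < mu_ n)
    (mu gamma : R)
    (hmu : mu_ n @[n --> \oo] --> mu)
    (hgamma : mu_ n / lambda n @[n --> \oo] --> gamma)
    (bhat : nat -> T -> 'cV[R]_p)
    (hbhat_rv : forall n : nat, random_vector (bhat n))
    (hbhat : forall (n : nat) (w : T),
       is_slasso (X n) (X n *m bstar + \col_(i < n) eps n i w)
         (lambda n) (mu_ n) (bhat n w))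
    (hcons : cvg_in_probability P bhat bstar)
    (hsel : P [set w | active (bhat n w) = active bstar] @[n --> \oo] --> 1%E)
    (j : 'I_p) (hj : j \in ~: active bstar) :
  let A := active bstar in
  `| (subrow_of j A C
        *m invmx (submx_of A A C + mu *: submx_of A A (Jtilde R p))
        *m (2^-1 *: Sgn (subvec_of A bstar)
            + gamma *: (submx_of A A (Jtilde R p) *m subvec_of A bstar))
      - gamma *: (subrow_of j A (Jtilde R p) *m subvec_of A bstar)) 0 0 |
  <= 1.
Proof.
have jA : j \notin active bstar by move: hj; rewrite finset.in_setC.
move=> /=.
apply: (@le_trans _ _ 2^-1); last by rewrite invf_le1 ?ler1n.
exact: (selection_bias_le_half hsigma heps hC hCpos hlambda hmu_ hmu hgamma
  hbhat_rv hbhat hcons hsel jA).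
Qed.
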